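(* (i) There is a family of $s$-$t$-graphs $(G_n)_{n}$, with the number of vertices of $G_n$ tending to infinity, such that every local contraction algorithm outputs an $s$-$t$-mincut of $G_n$ only with a probability that is exponentially small in the number of vertices of $G_n$. (ii) There is a family of graphs $(G_n)_n$, with the number of vertices tending to infinity, such that every local contraction algorithm outputs a normalized cut of $G_n$ only with a probability that is exponentially small in the number of vertices of $G_n$.
   Context: All graphs are undirected, connected, with non-negative edge weights $w$. For $A,B\subseteq V$, $w(A,B)=\sum_{a\in A,b\in B} w_{ab}$ ($w_{ab}=0$ if there is no edge). A cut is a partition $V=A\cup B$ into disjoint nonempty sets with cost $w(A,B)$. An $s$-$t$-graph is a graph with two distinguished vertices $s\neq t$; an $s$-$t$-cut is a cut $(S,T)$ with $s\in S,t\in T$, and an $s$-$t$-mincut is one of minimal cost. The normalized cut cost is $\mathrm{ncut}(A,B)=\frac{w(A,B)}{w(A,V)}+\frac{w(A,B)}{w(B,V)}$; a normalized cut is a cut minimizing it. Contraction of vertices $v_1,v_2$: remove them and their edges, add a new vertex $u$ joined to each former neighbor $x\notin\{v_1,v_2\}$ of $v_i$ with the same weight, merging parallel edges by adding weights. A general contraction algorithm is specified by a score function $\mathcal{W}(e;A,s,t)\ge0$ for edges $e$ of a graph with weighted adjacency matrix $A$ (and optional seeds $s,t$); while more than 2 vertices remain, it picks an edge of the current graph with probability proportional to its score and contracts it (a vertex obtained by contracting $s$ (resp. $t$) with another vertex becomes the new $s$ (resp. $t$)); the final two vertices define the output cut of the original graph. The neighborhood $N(e)$ of an edge $e=\{u,v\}$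 is the subgraph induced by the set of vertices that are neighbors of $u$ or of $v$ (with all edges of the graph between them). Two neighborhoods are considered the same if there is a graph isomorphism between them which also maps $s$ to $s$ and $t$ to $t$ where applicable. A general contraction algorithm is local if its score can be written as $\mathcal{W}(N(e),G)$, i.e. a function only of the (isomorphism class of the) neighborhood of $e$ and of the current graph $G$ as a whole; in particular edges of the same graph with isomorphic neighborhoods receive equal scores. *)

(* Defs.v *)
From mathcomp Require Import all_boot all_order all_algebra.
From mathcomp Require Import reals.
Set Implicit Arguments.
Unset Strict Implicit.
Unset Printing Implicit Defensive.
Import Order.TTheory GRing.Theory Num.Theory.
Local Open Scope ring_scope.

(* A graph is given by its weighted adjacency matrix [wt]; the edges are the
   pairs of nonzero weight, so a non-edge is the same as weight 0.  Each seed is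
   separately optional, because a neighborhood may contain only one of them; the
   two seeds may coincide, because an edge joining them may be contracted. *)
Record graph (R : realType) := Graph {
  vert :> finType;
  wt : vert -> vert -> R;
  source : option vert;
  sink : option vert;
  wt_sym : forall x y, wt x y = wt y x;
  wt_ge0 : forall x y, 0 <= wt x y;
  wt_irr : forall x, wt x x = 0 }.

Section Graphs.
Variable R : realType.
Implicit Types G N : graph R.

Definition nb_vertices G : nat := #|vert G|.

Definition adj G : rel G := fun x y => wt x y != 0.

Definition edges G : {set {set G}} :=
  [set e : {set G} | [exists x, exists y, adj x y && (e == [set x; y])]].

Definition connected_graph G : Prop := forall x y : G, connect (@adj G) x y.

Definition st_graph G : Prop :=
  exists s t : G, [/\ source G = Some s, sink G = Some t & s != t].

Definition unseeded G : Prop := source G = None /\ sink G = None.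

Definition weight G (A B : {set G}) : R := \sum_(a in A) \sum_(b in B) wt a b.

Definition is_cut G (A B : {set G}) : bool :=
  [&& A != set0, B != set0, [disjoint A & B]
    & A :|: B == [set: G]].

Definition is_st_cut G (S T : {set G}) : bool :=
  [&& is_cut S T, oapp (fun s => s \in S) false (source G)
    & oapp (fun t => t \in T) false (sink G)].

Definition is_st_mincut G (S T : {set G}) : bool :=
  is_st_cut S T &&
  [forall S' : {set G}, forall T' : {set G},
     is_st_cut S' T' ==> (weight S T <= weight S' T')].

Definition ncut G (A B : {set G}) : R :=
  weight A B / weight A [set: G] + weight A B / weight B [set: G].

Definition is_normalized_cut G (A B : {set G}) : bool :=
  is_cut A B &&
  [forall A' : {set G}, forall B' : {set G},
     is_cut A' B' ==> (ncut A B <= ncut A' B')].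

Section Contraction.
Variables (G : graph R) (e : {set G}).

(* The vertices of the contracted graph are [Some x] for the vertices x outside
   e, and the new vertex [None]; [insub] maps the two ends of e to [None]. *)
Definition contract_vert : finType := option {x : G | x \notin e}.

Definition contract_map : G -> contract_vert := insub.

Definition contract_wt (a b : contract_vert) : R :=
  match a, b with
  | Some x, Some y => wt (val x) (val y)
  | Some x, None => \sum_(z in e) wt (val x) z
  | None, Some y => \sum_(z in e) wt z (val y)
  | None, None => 0
  end.

Lemma contract_wt_sym a b : contract_wt a b = contract_wt b a.
Proof.
by case: a b => [x|] [y|] //=; rewrite ?(wt_sym (val x)) //;
  apply: eq_bigr => z _; rewrite wt_sym.
Qed.

Lemma contract_wt_ge0 a b : 0 <= contract_wt a b.
Proof.
by case: a b => [x|] [y|] //=; rewrite ?wt_ge0 //;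
  apply: sumr_ge0 => z _; rewrite wt_ge0.
Qed.

Lemma contract_wt_irr a : contract_wt a a = 0.
Proof. by case: a => [x|] //=; rewrite wt_irr. Qed.

Definition contraction : graph R :=
  @Graph R contract_vert contract_wt
    (omap contract_map (source G)) (omap contract_map (sink G))
    contract_wt_sym contract_wt_ge0 contract_wt_irr.

End Contraction.

Definition induced G (X : {set G}) : graph R :=
  @Graph R {x : G | x \in X} (fun x y => wt (val x) (val y))
    (obind insub (source G)) (obind insub (sink G))
    (fun x y => wt_sym (val x) (val y)) (fun x y => wt_ge0 (val x) (val y))
    (fun x => wt_irr (val x)).

Definition neighborhood G (e : {set G}) : graph R :=
  induced [set x : G | [exists u in e, adj u x]].

Definition isomorphic N N' : Prop :=
  exists f : N -> N',
    [/\ bijective f, forall x y, wt (f x) (f y) = wt x y,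
        omap f (source N) = source N' & omap f (sink N) = sink N'].

(* The values of [score] outside the edge set are irrelevant. *)
Record contraction_algorithm := ContractionAlgorithm {
  score : forall G, {set G} -> R;
  score_ge0 : forall G (e : {set G}), e \in edges G -> 0 <= score e }.

Definition local (W : contraction_algorithm) : Prop :=
  exists F : graph R -> graph R -> R,
    (forall N N' G, isomorphic N N' -> F N G = F N' G) /\
    (forall G (e : {set G}), e \in edges G ->
       score W e = F (neighborhood e) G).

(* The probability that, after k contractions starting from G, the partition of
   the vertices of G into the classes merged so far satisfies P.  If all scores
   are 0, the run stops without an output: division by 0 gives probability 0. *)
Fixpoint run_prob (W : contraction_algorithm) (k : nat) G :
    ({set {set G}} -> bool) -> R :=
  match k with
  | 0 => fun P => (P [set [set x] | x : G])%:R
  | k'.+1 => fun P =>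
      \sum_(e in edges G)
        score W e / (\sum_(e' in edges G) score W e') *
        run_prob W k' (G := contraction e)
          (fun C : {set {set contraction e}} =>
             P [set (@contract_map G e @^-1: B) | B : {set contraction e} in C])
  end.

(* Contracting an edge removes exactly one vertex, so two vertices are left
   after [nb_vertices G - 2] contractions. *)
Definition output_prob (W : contraction_algorithm) G
    (P : {set G} -> {set G} -> bool) : R :=
  run_prob W (nb_vertices G - 2) (G := G)
    (fun C => [exists A, exists B, (C == [set A; B]) && P A B]).

Definition exponentially_small (N : nat -> nat) (p : nat -> R) : Prop :=
  exists q C : R, 0 < q < 1 /\ forall n, p n <= C * q ^+ N n.

End Graphs.

(* Main.v *)
Require Import Defs.
From mathcomp Require Import all_boot all_order all_algebra.
From mathcomp Require Import reals.
From mathcomp Require Import lra ring.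

(** In a complete graph (all weights between distinct vertices positive) the
    neighborhood of every edge is the whole graph, and a contraction of a
    complete graph is complete.  Hence on complete graphs every local algorithm
    contracts uniformly chosen edges until the end, and it outputs a given cut
    into parts of sizes a and b with probability at most 2 / C(a + b, a).  For
    both parts of the theorem it is enough to have complete graphs whose only
    optimal cut is balanced: two clusters of m vertices, with weights 1 between
    the clusters, and weights m ^ 2 + 1 inside them, so that a single inner edge
    outweighs the whole cut between the clusters. *)

(** * Local algorithms on complete graphs *)

Section UniformContraction.
Set Implicit Arguments.
Unset Strict Implicit.
Unset Printing Implicit Defensive.
Import Order.TTheory GRing.Theory Num.Theory.
Local Open Scope ring_scope.
Variable R : realType.
Implicit Types G : graph R.

Definition complete G : Prop := forall x y : G, x != y -> @adj R G x y.

Lemma complete_connected G : complete G -> connected_graph G.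
Proof.
move=> cG x y; have [->|nxy] := eqVneq x y; first exact: connect0.
exact/connect1/cG.
Qed.

Lemma edges_complete G : complete G -> edges G = [set e : {set G} | #|e| == 2%N].
Proof.
move=> cG; apply/setP=> e; rewrite !inE; apply/existsP/cards2P.
  case=> x /existsP[y /andP[axy /eqP ->]]; exists x, y; split=> //.
  by apply: contraNneq axy => ->; rewrite /adj wt_irr.
by case=> x [y [nxy ->]]; exists x; apply/existsP; exists y; rewrite cG //=.
Qed.

(** The weight between the new vertex and an old one is a sum over [e] of non-negative terms, at
    least one of them positive. *)
Lemma complete_contraction G (e : {set G}) :
  complete G -> e != set0 -> complete (contraction e).
Proof.
move=> cG /set0Pn[z ez].
have aux (f : G -> R) : (forall x, 0 <= f x) -> f z != 0 ->
    \sum_(x in e) f x != 0.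
  move=> f0 fz; rewrite (bigD1 z) //= gt_eqF // ltr_wpDr //.
    by apply: sumr_ge0.
  by rewrite lt_def fz f0.
move=> [x|] [y|] //; rewrite /adj /= => nxy.
- by apply: cG; apply: contraNneq nxy => /val_inj ->.
- apply: aux => [u|]; first exact: wt_ge0.
  by apply: cG; case: x {nxy} => x /=; apply: contraNneq => ->.
- apply: aux => [u|]; first exact: wt_ge0.
  by apply: cG; case: y {nxy} => y /=; apply: contraNneq => <-.
Qed.

(** Each end of an edge is a neighbor of the other end, and every further vertex is a neighbor of
    both, so all edges have the same neighborhood, induced by the whole vertex set. *)
Lemma local_score_complete (W : contraction_algorithm R) G :
  local W -> complete G ->
  exists s : R, forall e : {set G}, e \in edges G -> score W e = s.
Proof.
move=> [F [_ FW]] cG; exists (F (induced [set: G]) G) => e eG.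
rewrite FW // /neighborhood; congr (F (induced _) G).
apply/setP=> z; rewrite !inE; apply/existsP.
move: eG; rewrite edges_complete // inE => /cards2P[x [y [nxy ->]]].
have [->|nzx] := eqVneq z x.
  by exists y; rewrite !inE eqxx orbT /= cG // eq_sym.
by exists x; rewrite !inE eqxx /= cG // eq_sym.
Qed.

Lemma run_prob_pred0 (W : contraction_algorithm R) k G
    (P : {set {set G}} -> bool) :
  (forall C, ~~ P C) -> run_prob W k P = 0.
Proof.
elim: k G P => [|k IHk] G P nP /=; first by rewrite (negbTE (nP _)).
by rewrite big1 // => e _; rewrite IHk ?mulr0.
Qed.

(** * Vertex sets under contraction *)

Section ContractMap.
Variables (G : graph R) (e : {set G}).
Hypothesis e0 : e != set0.

Lemma contract_map_eq (x y : G) :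
  (contract_map e x == contract_map e y) = (x == y) || (x \in e) && (y \in e).
Proof.
rewrite /contract_map.
case: insubP => [u xe ux|/negPn xe]; case: insubP => [v ye vy|/negPn ye].
- by rewrite (negbTE xe) orbF -ux -vy val_eqE.
- rewrite (negbTE xe) orbF.
  by apply/esym; apply: contraNF xe => /eqP ->.
- rewrite (negbTE ye) andbF orbF.
  by apply/esym; apply: contraNF ye => /eqP <-.
- by rewrite xe ye orbT.
Qed.

Lemma contract_map_surj (b : contraction e) : exists x, contract_map e x = b.
Proof.
case: b => [u|]; first by exists (val u); rewrite /contract_map valK.
by case/set0Pn: e0 => z ez; exists z; rewrite /contract_map insubF ?ez.
Qed.

(** This holds by surjectivity. It lets one recover a class of the contracted graph from its
    preimage when an output partition is pulled back. *)
Lemma preim_contract_map_inj :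
  injective (fun B : {set contraction e} => @contract_map R G e @^-1: B).
Proof.
move=> B B' /setP eqB; apply/setP=> b.
by have [x <-] := contract_map_surj b; have := eqB x; rewrite !inE.
Qed.

Lemma preim_contract_map (A : {set G}) : e \subset A ->
  @contract_map R G e @^-1: (@contract_map R G e @: A) = A.
Proof.
move=> eA; apply/setP=> x; rewrite inE; apply/imsetP/idP => [[y yA /eqP]|xA].
  rewrite contract_map_eq => /predU1P[->//|/andP[xe _]].
  exact: (subsetP eA).
by exists x.
Qed.

Lemma card_contract (A : {set G}) : e \subset A ->
  #|@contract_map R G e @: A| = (#|A| - #|e|).+1%N.
Proof.
move=> eA; have [z ez] := set0Pn _ e0.
have -> : @contract_map R G e @: A =
    contract_map e z |: (@contract_map R G e @: (A :\: e)).
  rewrite -imsetU1; apply/setP=> b; apply/imsetP/imsetP => -[x xA ->].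
    have [xe|xe] := boolP (x \in e).
      by exists z; rewrite ?setU11 //; apply/eqP; rewrite contract_map_eq xe ez orbT.
    by exists x; rewrite // !inE xe xA orbT.
  exists x => //; move: xA; rewrite !inE => /predU1P[->|/andP[]//].
  exact: (subsetP eA).
rewrite cardsU1 card_in_imset; last first.
  move=> x y; rewrite !inE => /andP[xe _] _ /eqP.
  by rewrite contract_map_eq (negbTE xe) orbF => /eqP.
rewrite cardsD (setIidPr eA) (_ : _ \notin _) //.
apply/negP=> /imsetP[y]; rewrite !inE => /andP[ye _] /eqP.
by rewrite contract_map_eq (negbTE ye) andbF orbF => /eqP zy; rewrite -zy ez in ye.
Qed.

End ContractMap.

(** * Bound on the probability of a given cut *)

(* The exact probability is [cut_bound a b / (a + b - 1)] for a, b > 0; without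
   the denominator the recursion still holds, as an inequality. *)
Definition cut_bound (a b : nat) : R := 2 / 'C(a + b, a)%:R.

Lemma cut_bound_sym a b : cut_bound a b = cut_bound b a.
Proof. by rewrite /cut_bound addnC -[in LHS](bin_sub (leq_addl b a)) addnK. Qed.

(** By absorption of binomials, both sides are multiples of (a + b) / C(a + b, a): the left terms
    have the factors [a.-1] and [b.-1], the right side has [(a + b).-1]. *)
Lemma cut_bound_step a b :
  'C(a, 2)%:R * cut_bound a.-1 b + 'C(b, 2)%:R * cut_bound a b.-1
  <= 'C(a + b, 2)%:R * cut_bound a b.
Proof.
have half c d : 'C(c, 2)%:R * cut_bound c.-1 d =
    c.-1%:R * (c + d)%:R / 'C(c + d, c)%:R.
  case: c => [|c]; first by rewrite bin0n !mul0r.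
  have /(congr1 (fun n => n%:R : R)) := mul_bin_diag (c + d).+1 c.
  have /(congr1 (fun n => n%:R : R)) := mul_bin_diag c.+1 1.
  rewrite /cut_bound /= addSn bin1 !natrM => h1 h2.
  have n1 : 'C(c + d, c)%:R != 0 :> R by rewrite pnatr_eq0 -lt0n bin_gt0 leq_addr.
  have n2 : 'C((c + d).+1, c.+1)%:R != 0 :> R.
    by rewrite pnatr_eq0 -lt0n bin_gt0 ltnS leq_addr.
  apply/eqP; rewrite mulrA eqr_div // [_ * 2]mulrC -h1 -[X in _ == X]mulrA h2.
  by rewrite !mulrA [_ * c%:R]mulrC.
have bnd0 : 0 <= ((a + b)%:R / 'C(a + b, a)%:R) :> R by rewrite divr_ge0.
have binC : 'C(b + a, b) = 'C(a + b, a).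
  by rewrite addnC -(bin_sub (leq_addl a b)) addnK.
rewrite [cut_bound a b.-1]cut_bound_sym !half binC [(b + a)%N]addnC.
rewrite -!mulrA -mulrDl -natrD.
have [ab0|ab0] := posnP (a + b)%N; first by rewrite ab0 bin0n mul0r mulr0 mul0r.
have -> : 'C(a + b, 2)%:R * cut_bound a b =
    (a + b).-1%:R * ((a + b)%:R / 'C(a + b, a)%:R).
  rewrite /cut_bound; have := mul_bin_diag (a + b) 1.
  rewrite bin1 => /(congr1 (fun n => n%:R : R)); rewrite !natrM => h.
  by rewrite [RHS]mulrA [_.-1%:R * _]mulrC h mulrCA mulrA.
rewrite ler_wpM2r ?ler_nat //.
by move: ab0; clear; case: a b => [|a] [|b] //= _; rewrite ?addn0 // addnS leqW.
Qed.

(** Induction on [k]. A uniformly chosen edge lies inside [A] or inside its complement, and then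
    shrinks that part by one vertex, or it joins the two, and then the cut is lost. Averaging gives
    the recursion of [cut_bound_step]. *)
Lemma run_prob_complete (W : contraction_algorithm R) k G
    (P : {set {set G}} -> bool) (A : {set G}) :
  local W -> complete G ->
  (forall C, P C -> (A \in C) && (~: A \in C)) ->
  run_prob W k P <= cut_bound #|A| #|~: A|.
Proof.
move=> Wloc; have bnd0 a b : 0 <= cut_bound a b by rewrite divr_ge0.
elim: k G P A => [|k IHk] G P A cG PA /=.
  (* Without contractions all classes are singletons, so both parts have size 1, where the bound is
     2 / C(2, 1) = 1. *)
  have [/PA|_] := boolP (P _); last exact: bnd0.
  case/andP=> /imsetP[x _ ->] /imsetP[y _ ->].
  by rewrite /cut_bound !cards1 divff // pnatr_eq0.
have [s sE] := local_score_complete Wloc cG.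
set S := \sum_(e' in edges G) score W e'.
have SE : S = 'C(#|G|, 2)%:R * s.
  rewrite /S (eq_bigr (fun=> s)) // sumr_const -[LHS]mulr_natl edges_complete //.
  by rewrite card_draws.
pose P' (e : {set G}) (C : {set {set contraction e}}) :=
  P [set (@contract_map R G e @^-1: B) | B : {set contraction e} in C].
pose a := #|A|; pose b := #|~: A|.
(* Stated for any [B], to be used for both [A] and [~: A]. *)
have inner (B : {set G}) (e : {set G}) : e \in edges G -> e \subset B ->
    (forall C, P C -> (B \in C) && (~: B \in C)) ->
    run_prob W k (P' e) <= cut_bound #|B|.-1 #|~: B|.
  rewrite edges_complete // inE => /eqP e2 eB PB.
  have e0 : e != set0 by rewrite -card_gt0 e2.
  have B2 : (2 <= #|B|)%N by rewrite -e2 subset_leq_card.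
  pose B' := @contract_map R G e @: B.
  have B'K : @contract_map R G e @^-1: B' = B := preim_contract_map eB.
  have B'CK : @contract_map R G e @^-1: (~: B') = ~: B by rewrite preimsetC B'K.
  have cardB' : #|B'| = #|B|.-1.
    by rewrite card_contract // e2 -subSn // subSS subn1.
  have cardB'C : #|~: B'| = #|~: B|.
    rewrite -B'CK; apply/esym.
    rewrite -(card_in_imset (f := contract_map e)); last first.
      move=> x y; rewrite B'CK !inE => xB _ /eqP.
      rewrite contract_map_eq => /predU1P[->//|/andP[xe _]].
      by rewrite (subsetP eB) in xB.
    apply: eq_card => c; have [x <-] := contract_map_surj e0 c.
    apply/imsetP/idP => [[y yB' ->]|xB']; last by exists x; rewrite // inE.
    by rewrite inE in yB'.
  rewrite -cardB' -cardB'C; apply: IHk => [|C].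
    exact: complete_contraction.
  rewrite /P' => /PB; rewrite -{1}B'K -B'CK !mem_imset //.
    exact: preim_contract_map_inj.
  exact: preim_contract_map_inj.
have bound e : e \in edges G -> run_prob W k (P' e) <=
    (if e \subset A then cut_bound a.-1 b else 0) +
    (if e \subset ~: A then cut_bound a b.-1 else 0).
  move=> eG; have [eA|eA] := boolP (e \subset A).
    by rewrite ler_wpDr ?inner //; case: ifP.
  rewrite add0r; have [eA'|eA'] := boolP (e \subset ~: A).
    have := inner (~: A) e eG eA'; rewrite setCK [cut_bound a _]cut_bound_sym.
    by apply=> C /PA; rewrite andbC.
  (* The ends of a crossing edge are merged, so [A] is not a preimage under [contract_map]. *)
  rewrite run_prob_pred0 // => C; apply/negP=> /PA/andP[/imsetP[B _ AB] _].
  move: eG; rewrite edges_complete // inE => /cards2P[x [y [_ exy]]].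
  have cxy : contract_map e x = contract_map e y.
    by apply/eqP; rewrite contract_map_eq exy !inE !eqxx !orbT.
  have xyA : (x \in A) = (y \in A) by rewrite AB !inE cxy.
  move: eA eA'; rewrite exy !subUset !sub1set !inE xyA !andbb.
  by move=> ->.
have count (B : {set G}) c : \sum_(e in edges G) (if e \subset B then c else 0)
    = 'C(#|B|, 2)%:R * c :> R.
  rewrite -big_mkcondr /= sumr_const -[LHS]mulr_natl -cards_draws edges_complete //.
  by congr (_%:R * _); apply: eq_card => e; rewrite -topredE /= !inE andbC.
(* If all scores vanish, the run stops and the probability is 0. *)
have [s0|s0] := eqVneq s 0.
  by rewrite big1 // => e eG; rewrite sE // s0 !mul0r.
have [->|eG0] := eqVneq (edges G) set0; first by rewrite big_set0.
have C0 : 0 < 'C(#|G|, 2)%:R :> R.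
  by rewrite -card_draws -edges_complete // ltr0n card_gt0.
apply: (@le_trans _ _ (\sum_(e in edges G) ('C(#|G|, 2)%:R)^-1 *
   ((if e \subset A then cut_bound a.-1 b else 0) +
    (if e \subset ~: A then cut_bound a b.-1 else 0)))).
  apply: ler_sum => e eG; rewrite sE // SE invfM mulrCA divff // mulr1.
  by rewrite ler_wpM2l ?invr_ge0 ?ler0n // bound.
rewrite -mulr_sumr big_split /= !count mulrC ler_pdivrMr // [leRHS]mulrC.
have -> : #|G| = (a + b)%N by rewrite /a /b cardsC.
exact: cut_bound_step.
Qed.

End UniformContraction.

(** * The graph of two clusters *)

Section TwoClusters.
Set Implicit Arguments.
Unset Strict Implicit.
Unset Printing Implicit Defensive.
Import Order.TTheory GRing.Theory Num.Theory.
Local Open Scope ring_scope.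
Variables (R : realType) (n : nat) (s t : option (bool * 'I_n.+1)).

Definition cluster_wt (x y : bool * 'I_n.+1) : R :=
  if x.1 == y.1 then (if x.2 == y.2 then 0 else (n.+1 ^ 2).+1%:R) else 1.

Lemma cluster_wt_sym x y : cluster_wt x y = cluster_wt y x.
Proof. by rewrite /cluster_wt eq_sym [x.2 == _]eq_sym. Qed.

Lemma cluster_wt_ge0 x y : 0 <= cluster_wt x y.
Proof. by rewrite /cluster_wt; case: ifP => // _; case: ifP. Qed.

Lemma cluster_wt_irr x : cluster_wt x x = 0.
Proof. by rewrite /cluster_wt !eqxx. Qed.

(** Each cluster has m = [n.+1] vertices. The seeds are parameters, so that one construction serves
    both parts of the theorem. *)
Definition two_clusters : graph R :=
  @Graph R (bool * 'I_n.+1)%type cluster_wt s t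
    cluster_wt_sym cluster_wt_ge0 cluster_wt_irr.

Definition cluster (i : bool) : {set two_clusters} :=
  [set x : bool * 'I_n.+1 | x.1 == i].

Lemma complete_two_clusters : complete two_clusters.
Proof.
move=> [i x] [j y]; rewrite xpair_eqE /adj /= /cluster_wt /=.
by case: eqP => // _; case: eqP => // _ _; rewrite ?pnatr_eq0 ?oner_eq0.
Qed.

Lemma card_cluster i : #|cluster i| = n.+1.
Proof.
have -> : cluster i = setX [set i] [set: 'I_n.+1].
  by apply/setP=> -[j x]; rewrite !inE andbT.
by rewrite cardsX cards1 cardsT card_ord mul1n.
Qed.

Lemma nb_vertices_two_clusters : nb_vertices two_clusters = n.+1.*2.
Proof. by rewrite /nb_vertices card_prod card_bool card_ord mul2n. Qed.

Lemma setC_cluster i : ~: cluster i = cluster (~~ i).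
Proof. by apply/setP=> -[j x]; rewrite !inE; case: i j => [] []. Qed.

(** * Optimal cuts of the two clusters *)

Lemma is_cutP (G : graph R) (A B : {set G}) :
  is_cut A B -> [/\ A != set0, B != set0 & B = ~: A].
Proof.
case/and4P=> A0 B0 dAB /eqP AB; split=> //; apply/setP=> x.
have := in_setT x; rewrite -AB !inE.
by have [/(disjointFr dAB) ->|] := boolP (x \in A).
Qed.

Lemma is_cut_cluster i : is_cut (cluster i) (~: cluster i).
Proof.
rewrite /is_cut setUCr eqxx -setI_eq0 setICr eqxx setC_cluster.
by rewrite -!card_gt0 !card_cluster.
Qed.

Lemma weight_cluster i : weight (cluster i) (~: cluster i) = (n.+1 ^ 2)%:R.
Proof.
rewrite /weight (eq_bigr (fun=> n.+1%:R)) => [|x].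
  by rewrite sumr_const card_cluster -[LHS]mulr_natl -natrM mulnn.
rewrite inE => /eqP xi; rewrite (eq_bigr (fun=> 1)) => [|y].
  by rewrite sumr_const setC_cluster card_cluster.
by rewrite !inE /= /cluster_wt xi eq_sym => /negbTE ->.
Qed.

Lemma weight_ge (G : graph R) (A B : {set G}) x y :
  x \in A -> y \in B -> wt x y <= weight A B.
Proof.
move=> xA yB; rewrite /weight (bigD1 x) //= (bigD1 y) //= -addrA lerDl.
by rewrite addr_ge0 ?sumr_ge0 // => ? _; rewrite ?sumr_ge0 // => *; apply: wt_ge0.
Qed.

(** Splitting a cluster would cut an inner edge, which alone costs m ^ 2 + 1. Hence [A] is a union
    of clusters, and since [B] is nonempty it is a single one. *)
Lemma light_cut (A B : {set two_clusters}) :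
  is_cut A B -> weight A B <= (n.+1 ^ 2)%:R -> exists i, A = cluster i.
Proof.
move=> /is_cutP[/set0Pn[[i x] xA] /set0Pn[[j y] yB] eB] wAB; exists i.
have full k u v : (k, u) \in A -> (k, v) \in A.
  move=> uA; apply/negPn/negP=> vA.
  have vB : (k, v) \in B by rewrite eB inE.
  have := le_trans (weight_ge uA vB) wAB; rewrite /= /cluster_wt /= eqxx.
  case: eqP => [uv|_]; first by rewrite -uv uA in vA.
  by rewrite ler_nat ltnn.
rewrite eB inE in yB.
have ij : j != i by apply: contraNneq yB => ->; apply: full xA.
apply/setP=> -[k z]; rewrite inE /=; apply/idP/eqP => [zA|->]; last exact: full xA.
apply/eqP; apply: contraNT yB => ki.
have -> : j = k by move: ij ki; case: (i) (j) (k) => [] [] [].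
exact: full zA.
Qed.

(** The weighted degree, the same for all vertices. *)
Definition cluster_deg : R := n%:R * (n.+1 ^ 2).+1%:R + n.+1%:R.

Lemma cluster_deg_gt0 : 0 < cluster_deg.
Proof. by rewrite ltr_wpDl ?mulr_ge0 ?ler0n ?ltr0n. Qed.

Lemma volume (A : {set two_clusters}) :
  weight A [set: two_clusters] = #|A|%:R * cluster_deg.
Proof.
rewrite /weight (eq_bigr (fun=> cluster_deg)) => [|[i x] _].
  by rewrite sumr_const [RHS]mulr_natl.
rewrite (eq_bigl predT) => [|y]; last by rewrite inE.
rewrite (eq_bigr (fun p => cluster_wt (i, x) (p.1, p.2))) => [|[]] //.
rewrite -(pair_bigA _ (fun j y => cluster_wt (i, x) (j, y))) /=.
rewrite (bigD1 i) //= (bigD1 (~~ i)) /=; last by case: i.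
rewrite [X in _ + (_ + X)]big1 ?addr0 => [|j]; last by case: i j => [] [].
rewrite /cluster_wt /= eqxx; congr (_ + _).
  rewrite (bigD1 x) //= eqxx add0r (eq_bigr (fun=> (n.+1 ^ 2).+1%:R)).
    by rewrite sumr_const cardC1 card_ord [RHS]mulr_natl.
  by move=> y; rewrite eq_sym => /negbTE ->.
rewrite (eq_bigr (fun=> 1)) => [|y _]; first by rewrite sumr_const card_ord.
by case: i.
Qed.

(** The seeds lie in different clusters, so the cut between the clusters competes and forces a cost
    of at most m ^ 2. *)
Lemma st_mincut_cluster (A B : {set two_clusters}) a b :
  s = Some (true, a) -> t = Some (false, b) -> is_st_mincut A B ->
  is_cut A B /\ exists i, A = cluster i.
Proof.
move=> sE tE /andP[/and3P[cAB _ _] /forallP/(_ (cluster true))].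
move=> /forallP/(_ (~: cluster true)); rewrite weight_cluster => /implyP wAB.
split=> //; apply: (light_cut cAB); apply: wAB.
by rewrite /is_st_cut is_cut_cluster /= sE tE /= !inE.
Qed.

(** With parts of sizes x + y = 2m, degree d and cost c, the normalized cost is 2mc / (xyd), against
    2m / d for the clusters. Optimality gives c <= xy <= m ^ 2, so the cut is light. *)
Lemma normalized_cut_cluster (A B : {set two_clusters}) :
  is_normalized_cut A B -> is_cut A B /\ exists i, A = cluster i.
Proof.
move=> /andP[cAB /forallP/(_ (cluster true))].
move=> /forallP/(_ (~: cluster true)); rewrite is_cut_cluster /= => nAB.
split=> //; apply: (light_cut cAB).
have [A0 B0 BE] := is_cutP cAB.
have cardAB : #|A|%:R + #|B|%:R = 2 * n.+1%:R :> R.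
  by rewrite BE -natrD cardsC -/(nb_vertices _) nb_vertices_two_clusters -mul2n natrM.
move: nAB; rewrite /ncut !volume weight_cluster setC_cluster !card_cluster.
rewrite -card_gt0 -(ltr0n R) in A0; rewrite -card_gt0 -(ltr0n R) in B0.
have := cluster_deg_gt0; move: cardAB A0 B0; rewrite natrX.
have : 0 < n.+1%:R :> R by [].
have : 0 <= weight A B by rewrite sumr_ge0 // => ? _; rewrite sumr_ge0 // => *; apply: wt_ge0.
move: (#|A|%:R) (#|B|%:R) (n.+1%:R) cluster_deg (weight A B) => x y m d c.
move=> c0 m0 xy x0 y0 d0.
have -> : c / (x * d) + c / (y * d) = c * (2 * m) / (x * y * d).
  by rewrite -xy; field; rewrite !gt_eqF.
have -> : m ^+ 2 / (m * d) + m ^+ 2 / (m * d) = 2 * m / d.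
  by field; rewrite !gt_eqF.
rewrite ler_pdivrMr ?mulr_gt0 // => h.
have dK : 2 * m / d * (x * y * d) = 2 * m * (x * y) by field; rewrite gt_eqF.
rewrite dK mulrC ler_pM2l ?mulr_gt0 // in h; apply: le_trans h _.
have := sqr_ge0 (x - y); nra.
Qed.

(** * Exponential decay and the two families *)

Lemma output_prob_cluster (W : contraction_algorithm R)
    (P : {set two_clusters} -> {set two_clusters} -> bool) : local W ->
  (forall A B, P A B -> is_cut A B /\ exists i, A = cluster i) ->
  output_prob W P <= 2 * (3 / 4) ^+ nb_vertices two_clusters.
Proof.
move=> Wloc HP; rewrite /output_prob.
apply: (le_trans (run_prob_complete (A := cluster true) _ Wloc complete_two_clusters _)).
  move=> C /existsP[A /existsP[B /andP[/eqP -> /HP[/is_cutP[_ _ ->] [i ->]]]]].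
  by rewrite !setC_cluster; case: i; rewrite !inE !eqxx ?orbT.
rewrite setC_cluster !card_cluster nb_vertices_two_clusters.
rewrite /cut_bound -mul2n exprM ler_pM2l //.
(* By Pascal's rule, the central binomial coefficient at least doubles at each step. *)
have binge m : (2 ^ m <= 'C(m + m, m))%N.
  elim: m => // m IHm; rewrite addSn addnS binS expnS mul2n -addnn.
  by rewrite leq_add // (leq_trans IHm) ?leq_bin2l // binS leq_addl.
rewrite -[leLHS]mul1r ler_pdivrMr ?ltr0n ?bin_gt0 ?leq_addr //.
(* The base 3/4 works because (3/4) ^ 2 times 2 is 9/8, which is at least 1. *)
apply: (@le_trans _ _ (((3 / 4) ^+ 2) ^+ n.+1 * (2 ^+ n.+1))).
  by rewrite -exprMn exprn_ege1 //; lra.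
by rewrite ler_wpM2l ?exprn_ge0 -?natrX ?ler_nat //; lra.
Qed.

End TwoClusters.

Lemma exponentially_small_cluster (R : realType)
    (s t : forall n, option (bool * 'I_n.+1))
    (P : forall n, {set two_clusters R (s n) (t n)} ->
                   {set two_clusters R (s n) (t n)} -> bool) :
  (forall n A B, P n A B ->
     is_cut A B /\ exists i, A = cluster R (s n) (t n) i) ->
  forall W : contraction_algorithm R, local W ->
    exponentially_small (fun n => nb_vertices (two_clusters R (s n) (t n)))
      (fun n => output_prob W (@P n)).
Proof.
move=> HP W Wloc; exists (3 / 4)%R, 2%R; split; first by lra.
by move=> n; apply: output_prob_cluster => //; apply: HP.
Qed.

From mathcomp Require Import classical_sets filter.
Local Open Scope classical_set_scope.

Lemma nb_vertices_two_clusters_cvg (R : realType)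
    (s t : forall n, option (bool * 'I_n.+1)) :
  nb_vertices (two_clusters R (s n) (t n)) @[n --> \oo] --> \oo.
Proof.
move=> A [N _ NA]; exists N => // n /= Nn; apply: NA => /=.
by rewrite nb_vertices_two_clusters -addnn (leq_trans Nn) // leqW // leq_addr.
Qed.

Theorem theorem3 (R : realType) :
  (exists G : nat -> graph R,
     [/\ forall n, connected_graph (G n) /\ st_graph (G n),
         nb_vertices (G n) @[n --> \oo] --> \oo
       & forall W : contraction_algorithm R, local W ->
           exponentially_small (fun n => nb_vertices (G n))
             (fun n => output_prob W (@is_st_mincut R (G n)))]) /\
  (exists G : nat -> graph R,
     [/\ forall n, connected_graph (G n) /\ unseeded (G n),
         nb_vertices (G n) @[n --> \oo] --> \oo
       & forall W : contraction_algorithm R, local W ->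
           exponentially_small (fun n => nb_vertices (G n))
             (fun n => output_prob W (@is_normalized_cut R (G n)))]).
Proof.
split.
  (* One seed in each cluster, so that the cut between the clusters separates them. *)
  exists (fun n => two_clusters R (Some (true, ord0)) (Some (false, @ord0 n))).
  split=> [n||].
  - split; first exact/complete_connected/complete_two_clusters.
    by exists (true, ord0), (false, ord0).
  - exact: nb_vertices_two_clusters_cvg.
  - apply: exponentially_small_cluster => n A B.
    exact: (st_mincut_cluster erefl erefl).
exists (fun n => two_clusters R None (None : option (bool * 'I_n.+1))).
split=> [n||].
- by split; first exact/complete_connected/complete_two_clusters.
- exact: nb_vertices_two_clusters_cvg.
- apply: exponentially_small_cluster => n A B.
  exact: normalized_cut_cluster.
Qed.
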